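(* Let $\mathbf{M}\in\mathbb{R}^{N\times N}$ be symmetric with eigenvalues $\lambda_1>\lambda_2>\cdots>\lambda_r>\lambda_{r+1}\ge\cdots\ge\lambda_N$, and let $d_{\min}=\min_{1\le s<j\le r+1}(\lambda_s-\lambda_j)$. Set $\epsilon=\frac{1}{72}r^{-1}d_{\min}$ and $\eta=0.11\,d_{\min}$. Then for every $\mathbf{X}\in\mathrm{St}(N,r)$ with $\|\mathrm{grad}\,g(\mathbf{X})\|_F\le\epsilon$ we have $|\lambda_{\min}(\mathrm{hess}\,g(\mathbf{X}))|\ge\eta$.
   Context: $\mathrm{St}(N,r)=\{\mathbf{X}\in\mathbb{R}^{N\times r}:\mathbf{X}^\top\mathbf{X}=\mathbf{I}_r\}$, $\mathbf{N}=\mathrm{diag}(r,r-1,\dots,1)\in\mathbb{R}^{r\times r}$, $g(\mathbf{X})=-\tfrac12\mathrm{tr}(\mathbf{X}^\top\mathbf{M}\mathbf{X}\mathbf{N})$ on $\mathrm{St}(N,r)$. $\mathcal{T}_{\mathbf{X}}\mathrm{St}(N,r)=\{\mathbf{U}:\mathbf{X}^\top\mathbf{U}+\mathbf{U}^\top\mathbf{X}=\mathbf{0}\}$. $\mathrm{grad}\,g(\mathbf{X})=(\mathbf{X}\mathbf{X}^\top-\mathbf{I}_N)\mathbf{M}\mathbf{X}\mathbf{N}-\tfrac12\mathbf{X}[\mathbf{X}^\top\mathbf{M}\mathbf{X},\mathbf{N}]$ with $[\mathbf{A},\mathbf{B}]=\mathbf{A}\mathbf{B}-\mathbf{B}\mathbf{A}$;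 $\mathrm{hess}\,g(\mathbf{X})[\mathbf{U},\mathbf{U}]=\langle\mathbf{X}^\top\mathbf{M}\mathbf{X},\mathbf{U}^\top\mathbf{U}\mathbf{N}\rangle-\langle\mathbf{M},\mathbf{U}\mathbf{N}\mathbf{U}^\top\rangle$ for $\mathbf{U}\in\mathcal{T}_{\mathbf{X}}\mathrm{St}(N,r)$; $\lambda_{\min}(\mathrm{hess}\,g(\mathbf{X}))$ is the minimum of this form over $\mathbf{U}\in\mathcal{T}_{\mathbf{X}}\mathrm{St}(N,r)$ with $\|\mathbf{U}\|_F=1$. *)

(* Defs.v *)
From HB Require Import structures.
From mathcomp Require Import all_boot all_order all_algebra.
From mathcomp Require Import boolp classical_sets reals.
Set Implicit Arguments. Unset Strict Implicit. Unset Printing Implicit Defensive.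
Import Order.TTheory GRing.Theory Num.Theory.
Local Open Scope ring_scope.
Local Open Scope classical_set_scope.

Section Defs.
Variable R : realType.

Definition frob (m n : nat) (A : 'M[R]_(m, n)) : R :=
  Num.sqrt (\sum_(i < m) \sum_(j < n) A i j ^+ 2).

Definition inner (m n : nat) (A B : 'M[R]_(m, n)) : R := \tr (A^T *m B).

Definition comm (n : nat) (A B : 'M[R]_n) : 'M[R]_n := A *m B - B *m A.

Definition Ndiag (r : nat) : 'M[R]_r := diag_mx (\row_(i < r) (r - i)%:R).

Definition stiefel (N r : nat) (X : 'M[R]_(N, r)) : Prop := X^T *m X = 1%:M.

Definition tangent (N r : nat) (X U : 'M[R]_(N, r)) : Prop :=
  X^T *m U + U^T *m X = 0.

(* Riemannian gradient of g(X) = -1/2 tr(X^T M X N) *)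
Definition gradg (N r : nat) (M : 'M[R]_N) (X : 'M[R]_(N, r)) : 'M[R]_(N, r) :=
  (X *m X^T - 1%:M) *m M *m X *m Ndiag r
  - (2%:R^-1) *: (X *m comm (X^T *m M *m X) (Ndiag r)).

Definition hessg (N r : nat) (M : 'M[R]_N) (X U : 'M[R]_(N, r)) : R :=
  inner (X^T *m M *m X) (U^T *m U *m Ndiag r) - inner M (U *m Ndiag r *m U^T).

(* lambda_min(hess g(X)): minimum of the form over unit tangent vectors
   (taken as the infimum, which is attained by compactness). *)
Definition lam_min_hess (N r : nat) (M : 'M[R]_N) (X : 'M[R]_(N, r)) : R :=
  inf [set h : R | exists U : 'M[R]_(N, r),
         tangent X U /\ frob U = 1 /\ h = hessg M X U].

(* d_min = min_{0 <= s < j <= r} (lam s - lam j)   (0-indexed eigenvalues) *)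
Definition dmin (r : nat) (lam : nat -> R) : R :=
  \big[Order.min/(lam 0%N - lam 1%N)]_(s < r.+1)
     \big[Order.min/(lam 0%N - lam 1%N)]_(j < r.+1 | (s < j)%N) (lam s - lam j).

End Defs.

(* Main.v *)
Require Import Defs.
From HB Require Import structures.
From mathcomp Require Import all_boot all_order all_algebra.
From mathcomp Require Import boolp classical_sets reals.
From mathcomp Require Import ring lra.
Set Implicit Arguments. Unset Strict Implicit. Unset Printing Implicit Defensive.
Import Order.TTheory GRing.Theory Num.Theory.
Local Open Scope ring_scope.

(** Let [A = X^T M X], let [D] be its diagonal (the Ritz values [a_j]) and
    [E = M X - X D].  The two summands of the gradient are orthogonal, and
    the weights [r, ..., 1] are positive and pairwise at distance at least [1],
    so [|E| <= 2 |grad g(X)| <= d / (36 r) =: rho].  Hence every [a_j] is within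
    [rho] of an eigenvalue, and three cases are possible.
    - Some [a_j] lies near the bottom of the spectrum, [a_j <= lam_(r+1) + rho].
      The span of the [r] top eigenvectors contains [w <> 0] orthogonal to all
      columns of [X] but the [j]-th; moving column [j] along the part of [w]
      normal to [X] gives curvature at most [- (d - 2 rho)].
    - Otherwise the [a_j] are near pairwise distinct top eigenvalues, because
      two orthonormal vectors cannot both be close to the same eigenline.  If
      [a_i < a_j] for some [i < j], rotating columns [i] and [j] gives curvature
      at most [- (d - 2 rho) / 2].
    - Otherwise the [a_j] are decreasing.  A dimension count bounds [M] on the
      normal space of [X] by [lam_(r+1) + 2 rho], and the Hessian, which is
      block diagonal up to an error [3 r rho], is at least [14/36 d]. *)

Section Frobenius.
Context {R : realType}.

Lemma innerE m n (A B : 'M[R]_(m, n)) :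
  inner A B = \sum_i \sum_j A i j * B i j.
Proof.
rewrite /inner /mxtrace exchange_big /=; apply: eq_bigr => j _.
by rewrite mxE; apply: eq_bigr => i _; rewrite mxE.
Qed.

Lemma innerC m n (A B : 'M[R]_(m, n)) : inner A B = inner B A.
Proof. by rewrite /inner -mxtrace_tr trmx_mul trmxK. Qed.

Lemma innerDl m n (A B C : 'M[R]_(m, n)) :
  inner (A + B) C = inner A C + inner B C.
Proof. by rewrite /inner raddfD mulmxDl raddfD. Qed.

Lemma innerNl m n (A C : 'M[R]_(m, n)) : inner (- A) C = - inner A C.
Proof. by rewrite /inner raddfN mulNmx raddfN. Qed.

Lemma innerZl m n a (A C : 'M[R]_(m, n)) : inner (a *: A) C = a * inner A C.
Proof. by rewrite /inner linearZ /= -scalemxAl linearZ. Qed.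

Lemma innerDr m n (A B C : 'M[R]_(m, n)) :
  inner C (A + B) = inner C A + inner C B.
Proof. by rewrite innerC innerDl !(innerC C). Qed.

Lemma innerNr m n (A C : 'M[R]_(m, n)) : inner C (- A) = - inner C A.
Proof. by rewrite innerC innerNl innerC. Qed.

Lemma innerZr m n a (A C : 'M[R]_(m, n)) : inner C (a *: A) = a * inner C A.
Proof. by rewrite innerC innerZl innerC. Qed.

Lemma inner0l m n (A : 'M[R]_(m, n)) : inner 0 A = 0.
Proof. by rewrite /inner trmx0 mul0mx mxtrace0. Qed.

Lemma inner0r m n (A : 'M[R]_(m, n)) : inner A 0 = 0.
Proof. by rewrite innerC inner0l. Qed.

Lemma inner_tr m n (A B : 'M[R]_(m, n)) : inner A^T B^T = inner A B.
Proof. by rewrite innerC /inner trmxK mxtrace_mulC. Qed.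

Lemma inner_mull m n p (A : 'M[R]_(m, n)) (B : 'M_(n, p)) C :
  inner (A *m B) C = inner B (A^T *m C).
Proof. by rewrite /inner trmx_mul mulmxA. Qed.

Lemma inner_mulr m n p (A : 'M[R]_(m, n)) (B : 'M_(n, p)) C :
  inner (A *m B) C = inner A (C *m B^T).
Proof. by rewrite -inner_tr trmx_mul inner_mull trmxK -inner_tr trmx_mul !trmxK. Qed.

Lemma inner_ge0 m n (A : 'M[R]_(m, n)) : 0 <= inner A A.
Proof.
by rewrite innerE; apply: sumr_ge0 => i _; apply: sumr_ge0 => j _; rewrite -expr2 sqr_ge0.
Qed.

Lemma inner_eq0 m n (A : 'M[R]_(m, n)) : (inner A A == 0) = (A == 0).
Proof.
apply/eqP/eqP => [|->]; last by rewrite inner0l.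
rewrite innerE => /eqP; rewrite psumr_eq0 => [/allP H|i _]; last first.
  by apply: sumr_ge0 => j _; rewrite -expr2 sqr_ge0.
apply/matrixP => i j; rewrite mxE.
have := H i (mem_index_enum _); rewrite psumr_eq0 => [/allP Hi|k _]; last first.
  by rewrite -expr2 sqr_ge0.
by have := Hi j (mem_index_enum _); rewrite /= -expr2 sqrf_eq0 => /eqP.
Qed.

Lemma frobE m n (A : 'M[R]_(m, n)) : frob A = Num.sqrt (inner A A).
Proof.
by rewrite innerE; congr Num.sqrt; apply: eq_bigr => i _; apply: eq_bigr => j _; rewrite expr2.
Qed.

Lemma frob_ge0 m n (A : 'M[R]_(m, n)) : 0 <= frob A.
Proof. exact: sqrtr_ge0. Qed.

Lemma sqr_frob m n (A : 'M[R]_(m, n)) : frob A ^+ 2 = inner A A.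
Proof. by rewrite frobE sqr_sqrtr // inner_ge0. Qed.

Lemma frob_eq0 m n (A : 'M[R]_(m, n)) : (frob A == 0) = (A == 0).
Proof. by rewrite -inner_eq0 -sqr_frob sqrf_eq0. Qed.

Lemma frob_le m n p q (A : 'M[R]_(m, n)) (B : 'M[R]_(p, q)) :
  inner A A <= inner B B -> frob A <= frob B.
Proof. by move=> AB; rewrite !frobE ler_wsqrtr. Qed.

Lemma frob_tr m n (A : 'M[R]_(m, n)) : frob A^T = frob A.
Proof. by rewrite !frobE inner_tr. Qed.

Lemma inner_Cauchy_Schwarz m n (A B : 'M[R]_(m, n)) : `|inner A B| <= frob A * frob B.
Proof.
have [->|A0] := eqVneq A 0; first by rewrite inner0l normr0 mulr_ge0 ?frob_ge0.
have [->|B0] := eqVneq B 0; first by rewrite inner0r normr0 mulr_ge0 ?frob_ge0.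
have fA : 0 < frob A by rewrite lt_def frob_ge0 frob_eq0 A0.
have fB : 0 < frob B by rewrite lt_def frob_ge0 frob_eq0 B0.
have fAB := mulr_gt0 fA fB.
have h1 := inner_ge0 (frob B *: A - frob A *: B).
have h2 := inner_ge0 (frob B *: A + frob A *: B).
move: h1 h2; rewrite !(innerDl, innerDr, innerNl, innerNr, innerZl, innerZr).
rewrite (innerC B A) -!sqr_frob => h1 h2.
rewrite -(ler_pM2l fAB) -[X in X * `|_|](gtr0_norm fAB) -normrM ler_norml.
by apply/andP; split; lra.
Qed.

Lemma inner_sum_col m n (A B : 'M[R]_(m, n)) :
  inner A B = \sum_j inner (col j A) (col j B).
Proof.
rewrite innerE exchange_big /=; apply: eq_bigr => j _.
by rewrite innerE; apply: eq_bigr => i _; rewrite big_ord1 !mxE.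
Qed.

Lemma frob_mulmx m n p (A : 'M[R]_(m, n)) (B : 'M_(n, p)) :
  frob (A *m B) <= frob A * frob B.
Proof.
rewrite -ler_sqr ?nnegrE ?mulr_ge0 ?frob_ge0 // exprMn !sqr_frob innerE.
rewrite -(inner_tr A) !inner_sum_col mulr_suml; apply: ler_sum => i _.
rewrite mulr_sumr; apply: ler_sum => j _.
have -> : (A *m B) i j = inner (col i A^T) (col j B).
  by rewrite innerE mxE; apply: eq_bigr => k _; rewrite big_ord1 !mxE.
rewrite -!sqr_frob -exprMn -expr2 -[X in X <= _]real_normK ?num_real //.
by rewrite ler_sqr ?nnegrE ?mulr_ge0 ?frob_ge0 // inner_Cauchy_Schwarz.
Qed.

End Frobenius.

Section Spectral.
Context {R : realType}.

Lemma inner_delta m n (B : 'M[R]_(m, n)) i j : inner (delta_mx i j) B = B i j.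
Proof.
rewrite innerE (bigD1 i) //= (bigD1 j) //= !mxE !eqxx mul1r big1 => [|k kj].
  rewrite addr0 big1 ?addr0 // => k ki; rewrite big1 // => l _.
  by rewrite mxE (negbTE ki) mul0r.
by rewrite mxE (negbTE kj) andbF mul0r.
Qed.

Lemma inner_cV n (u v : 'cV[R]_n) : u^T *m v = (inner u v)%:M.
Proof. by rewrite /inner trace_mx11 -mx11_scalar. Qed.

Lemma householder n (v w : 'cV[R]_n) : inner v v = inner w w ->
  exists H : 'M[R]_n, [/\ H^T = H, H *m H = 1%:M & H *m w = v].
Proof.
have [->|vw] := eqVneq v w.
  by move=> _; exists 1%:M; rewrite trmx1 !mul1mx.
move=> vvww; set p := v - w.
have p0 : inner p p != 0 by rewrite inner_eq0 subr_eq0.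
exists (1%:M - (2 / inner p p) *: (p *m p^T)); split.
- by rewrite linearB linearZ /= trmx1 trmx_mul trmxK.
- have pp : p *m p^T *m (p *m p^T) = inner p p *: (p *m p^T).
    by rewrite mulmxA -(mulmxA p) inner_cV mul_mx_scalar -scalemxAl.
  rewrite mulmxBl mul1mx mulmxBr mulmx1 -scalemxAl -scalemxAr pp !scalerA.
  rewrite (_ : _ * inner p p = 2 / inner p p + 2 / inner p p); last by field.
  by rewrite scalerDl opprB addrK subrK.
- rewrite mulmxBl mul1mx -scalemxAl -mulmxA inner_cV mul_mx_scalar scalerA.
  rewrite (_ : _ * _ = -1); first by rewrite scaleN1r opprK /p addrC subrK.
  have e : inner p p = - 2 * inner p w.
    rewrite /p !(innerDl, innerDr, innerNl, innerNr) vvww (innerC w v); ring.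
  by move: p0; rewrite e => p0; field; move: p0; rewrite mulf_eq0 negb_or => /andP[].
Qed.

Lemma char_poly_conj n (H M : 'M[R]_n) : H *m H = 1%:M ->
  char_poly (H *m M *m H) = char_poly M.
Proof.
move=> HH; rewrite /char_poly /char_poly_mx.
have HH' : map_mx polyC H *m map_mx polyC H = 1%:M by rewrite -map_mxM HH map_mx1.
have -> : 'X%:M - map_mx polyC (H *m M *m H)
   = map_mx polyC H *m ('X%:M - map_mx polyC M) *m map_mx polyC H.
  by rewrite mulmxBr mulmxBl -!map_mxM scalar_mxC -(mulmxA 'X%:M) HH' mulmx1.
by rewrite !det_mulmx mulrAC -det_mulmx HH' det1 mul1r.
Qed.

Lemma spectral_theorem n (M : 'M[R]_n) (lam : nat -> R) : M^T = M ->
  char_poly M = \prod_(i < n) ('X - (lam i)%:P) ->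
  exists Q : 'M[R]_n, Q^T *m Q = 1%:M /\
    M = Q *m diag_mx (\row_(i < n) lam i) *m Q^T.
Proof.
elim: n M lam => [|n IH] M lam Msym Mchar.
  by exists 1%:M; split; apply/matrixP => -[].
have : eigenvalue M (lam 0%N).
  rewrite eigenvalue_root_char Mchar big_ord_recl /=.
  by rewrite rootM root_XsubC eqxx.
case/eigenvalueP => u uM u0.
have fu0 : frob u != 0 by rewrite frob_eq0.
pose v := ((frob u)^-1 *: u)^T.
have vv : inner v v = 1.
  by rewrite inner_tr innerZl innerZr -sqr_frob; field.
have Mv : M *m v = lam 0%N *: v.
  by rewrite -[in LHS]Msym -trmx_mul -scalemxAl uM /v !linearZ /= !scalerA mulrC.
pose e : 'cV[R]_(1 + n) := delta_mx 0 0.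
have ee : inner v v = inner e e.
  by rewrite vv inner_delta mxE !eqxx.
have [H [HT HH Hev]] := householder ee.
pose M' : 'M[R]_(1 + n) := H *m M *m H.
have M'sym : M'^T = M' by rewrite /M' !trmx_mul HT Msym mulmxA.
have M'e : M' *m e = lam 0%N *: e.
  by rewrite -!mulmxA Hev Mv -scalemxAr -Hev mulmxA HH mul1mx.
have M'char : char_poly M' = char_poly M := char_poly_conj M HH.
have ME : M = H *m M' *m H by rewrite /M' !mulmxA HH mul1mx -mulmxA HH mulmx1.
clearbody M'.
have col0 i : M' i 0 = lam 0%N * (i == 0)%:R.
  by have /matrixP/(_ i 0) := M'e; rewrite -colE !mxE eqxx andbT.
have M'E : M' = block_mx (lam 0%N)%:M 0 0 (drsubmx M').
  rewrite -[LHS]submxK; congr block_mx; apply/matrixP => i j.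
  - rewrite !mxE !ord1 lshift0 col0 eqxx mulr1 mulr1n //.
  - rewrite !mxE -{1}M'sym mxE !ord1 lshift0 col0 eq_sym.
    by rewrite [_ == _](introF eqP) ?mulr0 // => /(congr1 val).
  - rewrite !mxE !ord1 lshift0 col0.
    by rewrite [_ == _](introF eqP) ?mulr0 // => /(congr1 val).
set M1 := drsubmx M' in M'E.
have M1sym : M1^T = M1 by rewrite /M1 trmx_drsub M'sym.
have M1char : char_poly M1 = \prod_(i < n) ('X - (lam i.+1)%:P).
  move: M'char; rewrite Mchar big_ord_recl /=.
  have -> : char_poly M' = ('X - (lam 0%N)%:P) * char_poly M1.
    rewrite M'E /char_poly /char_poly_mx map_block_mx scalar_mx_block.
    rewrite opp_block_mx add_block_mx !map_mx0 !subr0 det_ublock; congr (_ * _).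
    by rewrite det_mx11 !mxE eqxx !mulr1n.
  by move/(mulfI (negbT (polyXsubC_eq0 _))).
have [Q1 [QQ1 M1E]] := IH M1 (fun i => lam i.+1) M1sym M1char.
pose B : 'M[R]_(1 + n) := block_mx 1%:M 0 0 Q1.
have BT : B^T = block_mx 1%:M 0 0 Q1^T by rewrite tr_block_mx !trmx0 trmx1.
have BB : B^T *m B = 1%:M.
  rewrite BT /B mulmx_block !(mul0mx, mulmx0, mul1mx, addr0, add0r) QQ1.
  by rewrite -scalar_mx_block.
have M'B : M' = B *m diag_mx (\row_(i < 1 + n) lam i) *m B^T.
  have -> : diag_mx (\row_(i < 1 + n) lam i) =
     block_mx (lam 0%N)%:M 0 0 (diag_mx (\row_(i < n) lam i.+1)) :> 'M[R]_(1 + n).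
    by rewrite -[LHS]submxK; congr block_mx; apply/matrixP => i j; rewrite !mxE ?ord1.
  rewrite M'E BT /B !mulmx_block.
  by rewrite !(mul0mx, mulmx0, mul1mx, mulmx1, addr0, add0r) -M1E.
exists (H *m B); split.
  by rewrite trmx_mul HT mulmxA -(mulmxA B^T) HH mulmx1 BB.
by rewrite ME M'B trmx_mul HT !mulmxA.
Qed.

Lemma exists_ker m n (A : 'M[R]_(m, n)) : (m < n)%N ->
  exists2 w : 'cV[R]_n, w != 0 & A *m w = 0.
Proof.
move=> mn; pose K := kermx A^T; exists (nz_row K)^T.
  rewrite trmx_eq0 nz_row_eq0 -mxrank_eq0 mxrank_ker subn_eq0 -ltnNge.
  by apply: leq_ltn_trans mn; rewrite rank_leq_col.
apply: trmx_inj; rewrite trmx_mul trmxK trmx0.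
by apply/sub_kermxP; apply: nz_row_sub.
Qed.

End Spectral.

Section Stiefel.
Context {R : realType}.

Lemma inner_stiefel N r k (X : 'M[R]_(N, r)) (V W : 'M[R]_(r, k)) :
  stiefel X -> inner (X *m V) (X *m W) = inner V W.
Proof. by move=> XX; rewrite inner_mull mulmxA XX mul1mx. Qed.

Lemma inner_ortho N r k (X : 'M[R]_(N, r)) (V : 'M[R]_(r, k)) (Z : 'M_(N, k)) :
  X^T *m Z = 0 -> inner (X *m V) Z = 0.
Proof. by move=> XZ; rewrite inner_mull XZ inner0r. Qed.

Lemma pythagoras N r k (X : 'M[R]_(N, r)) (Z : 'M[R]_(N, k)) W :
  stiefel X -> X^T *m Z = 0 ->
  inner (Z + X *m W) (Z + X *m W) = inner Z Z + inner W W.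
Proof.
move=> XX XZ; rewrite innerDl !innerDr (innerC Z) !(inner_ortho _ XZ).
by rewrite inner_stiefel // addr0 add0r.
Qed.

Lemma stiefel_split N r k (X : 'M[R]_(N, r)) (U : 'M[R]_(N, k)) :
  stiefel X -> X^T *m (U - X *m (X^T *m U)) = 0.
Proof. by move=> XX; rewrite mulmxBr (mulmxA X^T X) XX mul1mx subrr. Qed.

Lemma inner_split N r k (X : 'M[R]_(N, r)) (U : 'M[R]_(N, k)) : stiefel X ->
  inner U U = inner (U - X *m (X^T *m U)) (U - X *m (X^T *m U))
              + inner (X^T *m U) (X^T *m U).
Proof.
move=> XX; rewrite -(pythagoras _ XX (stiefel_split U XX)).
by rewrite subrK.
Qed.

Lemma frob_trmulmx_le N r k (X : 'M[R]_(N, r)) (U : 'M[R]_(N, k)) :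
  stiefel X -> frob (X^T *m U) <= frob U.
Proof.
by move=> XX; apply: frob_le; rewrite (inner_split U XX) lerDr inner_ge0.
Qed.

Lemma inner_rank1 m n (u u' : 'cV[R]_m) (v v' : 'rV[R]_n) :
  inner (u *m v) (u' *m v') = inner u u' * inner v v'.
Proof. by rewrite inner_mull mulmxA inner_cV mul_scalar_mx innerZr. Qed.

Lemma inner_deltar m n (B : 'M[R]_(m, n)) i j : inner B (delta_mx i j) = B i j.
Proof. by rewrite innerC inner_delta. Qed.

Lemma Ndiag_ge1 r (i : 'I_r) : 1 <= (r - i)%:R :> R.
Proof. by rewrite ler1n subn_gt0. Qed.

Lemma Ndiag_decr r (i j : 'I_r) : (i < j)%N -> (r - j)%:R + 1 <= (r - i)%:R :> R.
Proof. by move=> ij; rewrite natr1 ler_nat ltn_sub2l. Qed.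

Lemma mul_NdiagE m r (U : 'M[R]_(m, r)) i j :
  (U *m Ndiag R r) i j = (r - j)%:R * U i j.
Proof. by rewrite /Ndiag mul_mx_diag !mxE mulrC. Qed.

Lemma mul_delta_Ndiag r (j : 'I_r) :
  delta_mx 0 j *m Ndiag R r = (r - j)%:R *: delta_mx 0 j :> 'rV[R]_r.
Proof.
apply/rowP => k; rewrite mul_NdiagE !mxE eqxx /=.
by have [->//|] := eqVneq k j; rewrite !mulr0.
Qed.

Lemma frob_mulN m r (U : 'M[R]_(m, r)) : frob (U *m Ndiag R r) <= r%:R * frob U.
Proof.
rewrite -ler_sqr ?nnegrE ?mulr_ge0 ?frob_ge0 // exprMn !sqr_frob !innerE mulr_sumr.
apply: ler_sum => i _; rewrite mulr_sumr; apply: ler_sum => j _.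
rewrite !mul_NdiagE -!expr2 exprMn ler_wpM2r ?sqr_ge0 //.
by rewrite ler_sqr ?nnegrE // ler_nat leq_subr.
Qed.

Lemma inner_mulN_ge m r (U : 'M[R]_(m, r)) :
  inner U U <= inner (U *m Ndiag R r) (U *m Ndiag R r).
Proof.
rewrite !innerE; apply: ler_sum => i _; apply: ler_sum => j _.
rewrite !mul_NdiagE -!expr2 exprMn ler_peMl ?sqr_ge0 //.
by rewrite exprn_ege1 // Ndiag_ge1.
Qed.

Section Residual.
Variables (N r : nat) (M : 'M[R]_N) (X : 'M[R]_(N, r)).
Hypotheses (Msym : M^T = M) (XX : stiefel X).

Definition rayleigh : 'M[R]_r := X^T *m M *m X.
Definition ritz : 'rV[R]_r := \row_j rayleigh j j.
Definition residual : 'M[R]_(N, r) := M *m X - X *m diag_mx ritz.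

Local Notation A := rayleigh.
Local Notation E := residual.
Local Notation D := (diag_mx ritz).

Lemma ritzE j : ritz 0 j = A j j.
Proof. by rewrite mxE. Qed.

Lemma comm_Ndiag_ge :
  inner (A - D) (A - D) <= inner (comm A (Ndiag R r)) (comm A (Ndiag R r)).
Proof.
rewrite !innerE; apply: ler_sum => i _; apply: ler_sum => j _.
have -> : comm A (Ndiag R r) i j = ((r - j)%:R - (r - i)%:R) * A i j.
  by rewrite mxE mul_NdiagE /Ndiag mul_diag_mx !mxE; ring.
rewrite -!expr2 exprMn !mxE -/(A).
have [->|ij] := eqVneq i j; first by rewrite mulr1n subrr expr0n mulr_ge0 ?sqr_ge0.
rewrite mulr0n subr0 ler_peMl ?sqr_ge0 //.
have [lt|lt|/val_inj e] := ltngtP i j.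
- by have := Ndiag_decr lt; nra.
- by have := Ndiag_decr lt; nra.
- by rewrite e eqxx in ij.
Qed.

Lemma residual_le_grad : inner E E <= 4 * inner (gradg M X) (gradg M X).
Proof.
pose Z := M *m X - X *m A.
have XZ : X^T *m Z = 0 by rewrite mulmxBr !mulmxA XX mul1mx subrr.
have XZN : X^T *m (- (Z *m Ndiag R r)) = 0 by rewrite mulmxN mulmxA XZ mul0mx oppr0.
have -> : E = Z + X *m (A - D) by rewrite mulmxBr addrA subrK.
have -> : gradg M X = - (Z *m Ndiag R r) + X *m (- (2^-1) *: comm A (Ndiag R r)).
  rewrite /gradg -/A -scalemxAr scaleNr; congr (_ - _).
  by rewrite /Z !mulmxBl opprB mul1mx /A !mulmxA.
rewrite !pythagoras // innerNl innerNr opprK innerZl innerZr.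
have := comm_Ndiag_ge; have := inner_mulN_ge Z; have := inner_ge0 Z.
by move=> h1 h2 h3; lra.
Qed.

Lemma rayleighE : A = D + X^T *m E.
Proof. by rewrite mulmxBr !mulmxA XX mul1mx addrC subrK. Qed.

Lemma mul_M_X : M *m X = X *m D + E.
Proof. by rewrite addrC subrK. Qed.

Lemma hessE U : hessg M X U = inner (U *m A - M *m U) (U *m Ndiag R r).
Proof.
by rewrite /hessg innerDl innerNl (inner_mull U) (inner_mulr M) mulmxA.
Qed.

Lemma hess_normal (u : 'cV[R]_N) j :
  hessg M X (u *m delta_mx 0 j) =
  (r - j)%:R * (ritz 0 j * inner u u - inner u (M *m u)).
Proof.
rewrite hessE -!mulmxA mul_delta_Ndiag -scalemxAr innerZr innerDl innerNl.
rewrite (mulmxA M) !inner_rank1 -rowE inner_delta !inner_deltar !mxE !eqxx /=.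
rewrite (innerC (M *m u)); ring.
Qed.

Lemma inner_colX i j : inner (col i X) (col j X) = (i == j)%:R.
Proof.
by rewrite !colE inner_stiefel // inner_delta mxE eqxx andbT.
Qed.

Lemma inner_colMX i j : inner (col i X) (M *m col j X) = A i j.
Proof.
by rewrite !colE inner_mull inner_delta !mulmxA -colE mxE.
Qed.

Definition rotation i j : 'M[R]_(N, r) :=
  col i X *m delta_mx 0 j - col j X *m delta_mx 0 i.

Lemma inner_rotation i j : i != j -> inner (rotation i j) (rotation i j) = 2.
Proof.
move=> ij; rewrite /rotation !(innerDl, innerDr, innerNl, innerNr) !inner_rank1.
rewrite !inner_colX !inner_delta !mxE !eqxx (eq_sym j i) (negbTE ij) /=; ring.
Qed.

Lemma tangent_rotation i j : tangent X (rotation i j).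
Proof.
rewrite /tangent /rotation [(_ - _)^T]linearB /= !trmx_mul !trmx_delta !colE mulmxBr mulmxBl.
rewrite !trmx_mul !trmx_delta !mulmxA XX -!(mulmxA _ X^T X) XX !mulmx1 !mul1mx.
by rewrite addrA subrK subrr.
Qed.

Lemma hess_rotation i j : i != j -> hessg M X (rotation i j) =
  ((r - j)%:R - (r - i)%:R) * (ritz 0 j - ritz 0 i).
Proof.
move=> ij; rewrite hessE /rotation.
rewrite 2!mulmxBl mulmxBr -!(mulmxA (col _ _)) !mul_delta_Ndiag -!scalemxAr.
rewrite -!rowE !(mulmxA M).
rewrite !(innerDl, innerDr, innerNl, innerNr, innerZl, innerZr) !inner_rank1.
rewrite !inner_colX !inner_deltar !(innerC (M *m _)) !inner_colMX !ritzE.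
rewrite ![row _ _ _ _]mxE ![delta_mx _ _ _ _]mxE.
rewrite !eqxx (eq_sym j i) (negbTE ij) /=; ring.
Qed.

Lemma hess_split Om K : X^T *m K = 0 ->
  hessg M X (X *m Om + K) =
  inner (Om *m D - D *m Om) (Om *m Ndiag R r) + inner (K *m D - M *m K) (K *m Ndiag R r)
  + (inner ((X *m Om + K) *m (X^T *m E)) ((X *m Om + K) *m Ndiag R r)
     - inner (E *m Om) ((X *m Om + K) *m Ndiag R r) - inner K (E *m Om *m Ndiag R r)).
Proof.
move=> XK; set U := X *m Om + K.
have XKD : X^T *m (K *m D) = 0 by rewrite mulmxA XK mul0mx.
have XKN : X^T *m (K *m Ndiag R r) = 0 by rewrite mulmxA XK mul0mx.
have -> : hessg M X U = inner (U *m D - X *m (D *m Om) - M *m K) (U *m Ndiag R r)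
   + inner (U *m (X^T *m E)) (U *m Ndiag R r) - inner (E *m Om) (U *m Ndiag R r).
  rewrite hessE rayleighE -innerDl -innerNl -innerDl; congr inner.
  have -> : M *m U = X *m (D *m Om) + E *m Om + M *m K.
    by rewrite /U mulmxDr (mulmxA M X) mul_M_X (mulmxDl _ E) -!mulmxA.
  rewrite mulmxDr; move: (U *m D) (U *m _) (X *m _) (E *m _) (M *m _) => a b c d e.
  by apply/matrixP => i j; rewrite !mxE; ring.
suff -> : inner (U *m D - X *m (D *m Om) - M *m K) (U *m Ndiag R r) =
  inner (Om *m D - D *m Om) (Om *m Ndiag R r) + inner (K *m D - M *m K) (K *m Ndiag R r)
  - inner K (E *m Om *m Ndiag R r) by ring.
have -> : U *m D - X *m (D *m Om) - M *m K = X *m (Om *m D - D *m Om) + (K *m D - M *m K).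
  by rewrite /U mulmxDl mulmxBr !mulmxA [X in X - _]addrAC !addrA.
rewrite /U mulmxDl -(mulmxA X) innerDl !innerDr inner_stiefel // inner_ortho // addr0.
suff -> : inner (K *m D - M *m K) (X *m (Om *m Ndiag R r)) = - inner K (E *m Om *m Ndiag R r) by ring.
rewrite innerDl innerNl innerC inner_ortho // add0r; congr (- _).
rewrite inner_mull Msym mulmxA mul_M_X mulmxDl innerDr -!mulmxA innerC.
by rewrite inner_ortho // add0r.
Qed.

Lemma hess_split_error Om K (rho : R) : X^T *m K = 0 -> frob E <= rho ->
  - (3 * (r%:R * rho) * inner (X *m Om + K) (X *m Om + K)) <=
  inner ((X *m Om + K) *m (X^T *m E)) ((X *m Om + K) *m Ndiag R r)
     - inner (E *m Om) ((X *m Om + K) *m Ndiag R r) - inner K (E *m Om *m Ndiag R r).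
Proof.
move=> XK Er; set U := X *m Om + K.
have rho0 : 0 <= rho := le_trans (frob_ge0 E) Er.
have UU : inner U U = inner K K + inner Om Om by rewrite /U addrC pythagoras.
have fOm : frob Om <= frob U by apply: frob_le; rewrite UU lerDr inner_ge0.
have fK : frob K <= frob U by apply: frob_le; rewrite UU lerDl inner_ge0.
have fU := frob_ge0 U; have fUN := frob_mulN U; have fE := frob_ge0 E.
have r0 : 0 <= r%:R :> R by [].
have key (m n : nat) (P Q : 'M[R]_(m, n)) : frob P <= rho * frob U -> frob Q <= r%:R * frob U ->
    `|inner P Q| <= r%:R * rho * inner U U.
  move=> hP hQ; apply: (le_trans (inner_Cauchy_Schwarz P Q)).
  rewrite -sqr_frob (_ : _ * _ ^+ 2 = (rho * frob U) * (r%:R * frob U)); last by ring.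
  by apply: ler_pM; rewrite ?frob_ge0.
have h1 : `|inner (U *m (X^T *m E)) (U *m Ndiag R r)| <= r%:R * rho * inner U U.
  apply: key => //; apply: (le_trans (frob_mulmx _ _)); rewrite mulrC ler_pM ?frob_ge0 //.
  exact: le_trans (frob_trmulmx_le E XX) Er.
have h2 : `|inner (E *m Om) (U *m Ndiag R r)| <= r%:R * rho * inner U U.
  by apply: key => //; apply: (le_trans (frob_mulmx _ _)); rewrite ler_pM ?frob_ge0.
have h3 : `|inner K (E *m Om *m Ndiag R r)| <= r%:R * rho * inner U U.
  rewrite -mulmxA innerC inner_mull innerC; apply: key.
    apply: (le_trans (frob_mulmx _ _)); rewrite frob_tr ler_pM ?frob_ge0 //.
  by apply: (le_trans (frob_mulN _)); rewrite ler_wpM2l.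
move: h1 h2 h3; rewrite !ler_norml => /andP[h1 _] /andP[_ h2] /andP[_ h3]; lra.
Qed.

Lemma skew_part_ge c Om : Om^T = - Om ->
  (forall i j : 'I_r, (i < j)%N -> c <= ritz 0 i - ritz 0 j) -> 0 <= c ->
  c / 2 * inner Om Om <= inner (Om *m D - D *m Om) (Om *m Ndiag R r).
Proof.
move=> Omskew hc c0.
have sq i j : Om i j ^+ 2 = Om j i ^+ 2.
  by have /matrixP/(_ i j) := Omskew; rewrite !mxE => ->; rewrite sqrrN.
set S := inner _ (_ *m Ndiag R r).
have S1 : S = \sum_i \sum_j (ritz 0 j - ritz 0 i) * (r - j)%:R * Om i j ^+ 2.
  rewrite /S innerE; apply: eq_bigr => i _; apply: eq_bigr => j _.
  rewrite mul_NdiagE mxE [X in _ + X]mxE mul_mx_diag mul_diag_mx.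
  by rewrite [X in X - _]mxE [X in _ - X]mxE; ring.
have S2 : S = \sum_i \sum_j (ritz 0 i - ritz 0 j) * (r - i)%:R * Om i j ^+ 2.
  by rewrite S1 exchange_big /=; apply: eq_bigr => i _; apply: eq_bigr => j _; rewrite (sq i j).
have : c * inner Om Om <= S + S; last by lra.
rewrite {1}S1 S2 -big_split innerE mulr_sumr; apply: ler_sum => i _.
rewrite -big_split mulr_sumr /=; apply: ler_sum => j _.
rewrite -mulrDl -expr2.
have [lt|lt|/val_inj ->] := ltngtP i j.
- by apply: ler_wpM2r; rewrite ?sqr_ge0 //; have := Ndiag_decr lt; have := hc _ _ lt; nra.
- by apply: ler_wpM2r; rewrite ?sqr_ge0 //; have := Ndiag_decr lt; have := hc _ _ lt; nra.
- have : Om j j = 0 by have /matrixP/(_ j j) := Omskew; rewrite !mxE; lra.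
  by move=> ->; rewrite expr0n !mulr0.
Qed.

Lemma normal_part_ge c gam K : X^T *m K = 0 -> 0 <= c ->
  (forall j, gam + c <= ritz 0 j) ->
  (forall u : 'cV[R]_N, X^T *m u = 0 -> inner u (M *m u) <= gam * inner u u) ->
  c * inner K K <= inner (K *m D - M *m K) (K *m Ndiag R r).
Proof.
move=> XK c0 hc hu; rewrite !inner_sum_col mulr_sumr; apply: ler_sum => j _.
have -> : col j (K *m Ndiag R r) = (r - j)%:R *: col j K.
  by apply/colP => i; rewrite [LHS]mxE mul_NdiagE !mxE.
have -> : col j (K *m D - M *m K) = ritz 0 j *: col j K - M *m col j K.
  rewrite raddfB /= [col j (M *m K)]colE -mulmxA -colE; congr (_ - _).
  by apply/colP => i; rewrite [LHS]mxE mul_mx_diag !mxE mulrC.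
have Xk : X^T *m col j K = 0 by rewrite colE mulmxA XK mul0mx.
have := hu _ Xk; have := hc j; have := Ndiag_ge1 j; have := inner_ge0 (col j K).
rewrite innerZr innerDl innerNl innerZl (innerC (M *m _)).
move: (inner (col j K) (col j K)) (inner (col j K) (M *m _)) (ritz 0 j) ((r - j)%:R) => x y a n.
move=> x0 n1 ha hy.
have : (gam + c) * x <= a * x by exact: ler_wpM2r.
have : 0 <= c * x by exact: mulr_ge0.
by nra.
Qed.

End Residual.
End Stiefel.

Section MinimalCurvature.
Context {R : realType}.
Variables (N r : nat) (M : 'M[R]_N) (X : 'M[R]_(N, r)).

Lemma tangentZ a U : tangent X U -> tangent X (a *: U).
Proof.
by rewrite /tangent [(_ *: _)^T]linearZ /= -scalemxAl -scalemxAr -scalerDr => ->; rewrite scaler0.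
Qed.

Lemma tangent_ortho U : X^T *m U = 0 -> tangent X U.
Proof.
by move=> XU; rewrite /tangent XU -[X in U^T *m X]trmxK -trmx_mul XU trmx0 addr0.
Qed.

Lemma hessZ a U : hessg M X (a *: U) = a ^+ 2 * hessg M X U.
Proof.
rewrite !hessE -!scalemxAl -scalemxAr -scalerBr innerZl innerZr; ring.
Qed.

Lemma frob_unit m n (U : 'M[R]_(m, n)) : U != 0 -> frob ((frob U)^-1 *: U) = 1.
Proof.
move=> U0; have fU : frob U != 0 by rewrite frob_eq0.
rewrite frobE innerZl innerZr -sqr_frob (_ : _ * _ = 1) ?sqrtr1 //; by field.
Qed.

Lemma lam_min_hess_le c U : tangent X U -> U != 0 ->
  hessg M X U <= c * inner U U -> lam_min_hess M X <= c.
Proof.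
move=> tU U0 hU; have fU : frob U != 0 by rewrite frob_eq0.
have U'S : hessg M X ((frob U)^-1 *: U) <= c.
  rewrite hessZ exprVn mulrC ler_pdivrMr ?sqr_frob // lt_def inner_ge0.
  by rewrite inner_eq0 U0.
apply: le_trans U'S; apply: ge_inf; last first.
  by exists ((frob U)^-1 *: U); rewrite frob_unit //; split => //; apply: tangentZ.
exists (- ((frob (X^T *m M *m X) + frob M) * frob (Ndiag R r))) => h [V [tV [fV ->]]].
have h1 : `|inner (X^T *m M *m X) (V^T *m V *m Ndiag R r)|
    <= frob (X^T *m M *m X) * frob (Ndiag R r).
  apply: (le_trans (inner_Cauchy_Schwarz _ _)); rewrite ler_wpM2l ?frob_ge0 //.
  apply: (le_trans (frob_mulmx _ _)); rewrite ler_piMl ?frob_ge0 //.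
  by apply: (le_trans (frob_mulmx _ _)); rewrite frob_tr fV mulr1.
have h2 : `|inner M (V *m Ndiag R r *m V^T)| <= frob M * frob (Ndiag R r).
  apply: (le_trans (inner_Cauchy_Schwarz _ _)); rewrite ler_wpM2l ?frob_ge0 //.
  apply: (le_trans (frob_mulmx _ _)); rewrite frob_tr fV mulr1.
  by apply: (le_trans (frob_mulmx _ _)); rewrite fV mul1r.
rewrite /hessg; move: h1 h2; rewrite !ler_norml => /andP[h1 _] /andP[_ h2]; lra.
Qed.

Lemma lam_min_hess_ge c : (0 < r)%N -> (r < N)%N ->
  (forall U, tangent X U -> c * inner U U <= hessg M X U) ->
  c <= lam_min_hess M X.
Proof.
move=> r0 rN hc; apply: lb_le_inf; last first.
  by move=> h [U [tU [fU ->]]]; have := hc U tU; rewrite -sqr_frob fU expr1n mulr1.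
have [u u0 Xu] := @exists_ker R r N X^T rN.
pose U := u *m (delta_mx 0 (Ordinal r0) : 'rV[R]_r).
have U0 : U != 0.
  by rewrite -inner_eq0 inner_rank1 inner_delta mxE !eqxx mulr1 inner_eq0.
exists (hessg M X ((frob U)^-1 *: U)), ((frob U)^-1 *: U).
rewrite frob_unit //; split => //; apply: tangentZ; apply: tangent_ortho.
by rewrite mulmxA Xu mul0mx.
Qed.

End MinimalCurvature.

Section Eigenbasis.
Context {R : realType}.
Variables (N : nat) (M Q : 'M[R]_N) (lam : nat -> R).
Hypotheses (QQ : stiefel Q) (ME : M = Q *m diag_mx (\row_(i < N) lam i) *m Q^T).

Local Notation z x := (Q^T *m x).

Lemma inner_eigen (x y : 'cV[R]_N) : inner x y = \sum_(t < N) z x t 0 * z y t 0.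
Proof.
have QQ' : Q *m Q^T = 1%:M by apply: mulmx1C.
rewrite -[x]mul1mx -QQ' -mulmxA inner_mull innerE !mulmxA -(mulmxA _ Q) QQ' mulmx1.
by apply: eq_bigr => t _; rewrite big_ord1.
Qed.

Lemma eigen_coord (x : 'cV[R]_N) t : z (M *m x) t 0 = lam t * z x t 0.
Proof.
rewrite ME !mulmxA QQ mul1mx -mulmxA mul_diag_mx.
by rewrite [LHS]mxE [(\row_i _) _ _]mxE.
Qed.

Lemma quad_eigen (x : 'cV[R]_N) : inner x (M *m x) = \sum_(t < N) lam t * z x t 0 ^+ 2.
Proof. by rewrite inner_eigen; apply: eq_bigr => t _; rewrite eigen_coord; ring. Qed.

Lemma resid_eigen (x : 'cV[R]_N) a : inner (M *m x - a *: x) (M *m x - a *: x) =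
  \sum_(t < N) (lam t - a) ^+ 2 * z x t 0 ^+ 2.
Proof.
rewrite inner_eigen; apply: eq_bigr => t _.
have -> : z (M *m x - a *: x) t 0 = (lam t - a) * z x t 0.
  by rewrite mulmxBr -scalemxAr mxE eigen_coord [X in _ + X]mxE [X in _ - X]mxE; ring.
ring.
Qed.

Lemma eigenvalue_near (x : 'cV[R]_N) a rho : x != 0 -> 0 <= rho ->
  inner (M *m x - a *: x) (M *m x - a *: x) <= rho ^+ 2 * inner x x ->
  exists t : 'I_N, `|lam t - a| <= rho.
Proof.
move=> x0 rho0 hx; apply: contrapT => far.
have pos (t : 'I_N) : 0 < (lam t - a) ^+ 2 - rho ^+ 2.
  rewrite subr_gt0 -[X in _ < X]real_normK ?num_real // ltr_sqr ?nnegrE //.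
  by rewrite ltNge; apply/negP => ht; apply: far; exists t.
have : \sum_(t < N) ((lam t - a) ^+ 2 - rho ^+ 2) * z x t 0 ^+ 2 == 0.
  rewrite eq_le; apply/andP; split; last first.
    by apply: sumr_ge0 => t _; rewrite mulr_ge0 ?sqr_ge0 // ltW.
  under eq_bigr do rewrite mulrBl.
  rewrite sumrB -resid_eigen -mulr_sumr subr_le0.
  by move: hx; rewrite (inner_eigen x x); under eq_bigr do rewrite -expr2.
rewrite psumr_eq0 => [/allP all0|t _]; last by rewrite mulr_ge0 ?sqr_ge0 // ltW.
move: x0; rewrite -inner_eq0 inner_eigen big1 ?eqxx // => t _.
have := all0 t (mem_index_enum _); rewrite /= mulf_eq0 gt_eqF //= sqrf_eq0.
by move=> /eqP ->; rewrite mul0r.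
Qed.

Lemma coord_concentrated (x : 'cV[R]_N) a rho (s : 'I_N) : 0 < rho ->
  inner (M *m x - a *: x) (M *m x - a *: x) <= rho ^+ 2 ->
  (forall t : 'I_N, t != s -> 2 * rho <= `|lam t - a|) ->
  \sum_(t | t != s) z x t 0 ^+ 2 <= 1 / 4.
Proof.
move=> rho0 hx far; rewrite -(ler_pM2l (_ : 0 < (2 * rho) ^+ 2)) ?exprn_gt0 ?mulr_gt0 //.
rewrite (_ : _ * (1 / 4) = rho ^+ 2); last by field.
apply: le_trans hx; rewrite resid_eigen [X in _ <= X](bigD1 s) //= mulr_sumr.
apply: ler_wpDl; first by rewrite mulr_ge0 ?sqr_ge0.
apply: ler_sum => t ts; rewrite ler_wpM2r ?sqr_ge0 //.
rewrite -[X in _ <= X]real_normK ?num_real // ler_sqr ?nnegrE ?far //.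
by rewrite mulr_ge0 // ltW.
Qed.

(* In [inner x y] the [s]-term is at least 3/4 in absolute value, the rest at most 1/4. *)
Lemma concentrated_not_ortho (x y : 'cV[R]_N) (s : 'I_N) :
  inner x x = 1 -> inner y y = 1 -> inner x y = 0 ->
  \sum_(t | t != s) z x t 0 ^+ 2 <= 1 / 4 ->
  \sum_(t | t != s) z y t 0 ^+ 2 <= 1 / 4 -> False.
Proof.
rewrite !inner_eigen !(bigD1 s (P := xpredT)) //=.
have h (a b : R) : a * b <= 1 / 2 * a ^+ 2 + 1 / 2 * b ^+ 2.
  by have := sqr_ge0 (a - b); nra.
have h' (a b : R) : - (1 / 2) * a ^+ 2 + - (1 / 2) * b ^+ 2 <= a * b.
  by have := sqr_ge0 (a + b); nra.
under eq_bigr do rewrite -expr2.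
move=> xx; under eq_bigr do rewrite -expr2.
move=> yy xy hx hy.
have u : \sum_(t | t != s) z x t 0 * z y t 0 <= 1 / 4.
  apply: (@le_trans _ _ (\sum_(t | t != s) (1 / 2 * z x t 0 ^+ 2 + 1 / 2 * z y t 0 ^+ 2))).
    by apply: ler_sum => t _.
  by rewrite big_split /= -!mulr_sumr; lra.
have l : - (1 / 4) <= \sum_(t | t != s) z x t 0 * z y t 0.
  apply: (@le_trans _ _ (\sum_(t | t != s) (- (1 / 2) * z x t 0 ^+ 2 + - (1 / 2) * z y t 0 ^+ 2))).
    by rewrite big_split /= -!mulr_sumr; lra.
  by apply: ler_sum => t _.
move: xx yy xy hx hy u l; rewrite -!expr2.
move: (z x s 0) (z y s 0) (\sum_(t | _) _) (\sum_(t | _) _) (\sum_(t | _) _) => a b p q o.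
move=> hap hbq hab hp hq ho1 ho2.
have : (a * b) ^+ 2 <= 1 / 16 by nra.
have a2 : 3 / 4 <= a ^+ 2 by lra.
have b2 : 3 / 4 <= b ^+ 2 by lra.
rewrite exprMn; nra.
Qed.

Lemma quad_top r c (v : 'cV[R]_r) (w := Q *m (pid_mx r : 'M[R]_(N, r)) *m v) :
  (forall t : 'I_N, (t < r)%N -> c <= lam t) -> c * inner w w <= inner w (M *m w).
Proof.
move=> hc; rewrite quad_eigen inner_eigen mulr_sumr; apply: ler_sum => t _.
rewrite -expr2.
have [tr|rt] := ltnP t r; first by rewrite ler_wpM2r ?sqr_ge0 ?hc.
rewrite /w !mulmxA QQ mul1mx mxE big1 ?expr0n ?mulr0 // => k _.
by rewrite mxE ltnNge rt andbF mul0r.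
Qed.

Lemma quad_bot r c (y : 'cV[R]_N) : (forall t : 'I_N, (r <= t)%N -> lam t <= c) ->
  (Q *m (pid_mx r : 'M[R]_(N, r)))^T *m y = 0 ->
  inner y (M *m y) <= c * inner y y.
Proof.
move=> hc Fy; rewrite quad_eigen inner_eigen mulr_sumr; apply: ler_sum => t _.
rewrite -expr2.
have [tr|rt] := ltnP t r; last by rewrite ler_wpM2r ?sqr_ge0 ?hc.
suff -> : z y t 0 = 0 by rewrite expr0n !mulr0.
have /colP/(_ (Ordinal tr)) := Fy; rewrite trmx_mul tr_pid_mx -mulmxA.
rewrite mxE (bigD1 t) //= mxE eqxx tr mul1r big1 => [|k kt]; first by rewrite addr0 => ->; rewrite mxE.
by rewrite mxE /= eq_sym -(inj_eq val_inj) /= in kt *; rewrite (negbTE kt) mul0r.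
Qed.

End Eigenbasis.

Section NearCritical.
Context {R : realType}.
Variables (N r : nat) (M Q : 'M[R]_N) (X : 'M[R]_(N, r)) (lam : nat -> R) (d rho : R).
Hypotheses (Msym : M^T = M) (XX : stiefel X) (QQ : stiefel Q).
Hypothesis ME : M = Q *m diag_mx (\row_(i < N) lam i) *m Q^T.
Hypothesis rN : (r < N)%N.
Hypothesis gap : forall s t : nat, (s < r)%N -> (s < t)%N -> (t < N)%N -> d <= lam s - lam t.
Hypothesis bottom : forall t : nat, (r <= t)%N -> (t < N)%N -> lam t <= lam r.
Hypotheses (rho_gt0 : 0 < rho) (rho_small : 36 * rho <= d).
Hypothesis resid : frob (residual M X) <= rho.

Local Notation E := (residual M X).
Local Notation a := (ritz M X 0).
Local Notation x j := (col j X).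

Lemma col_residual j : col j E = M *m x j - a j *: x j.
Proof.
rewrite /residual raddfB /= [col j (M *m X)]colE -mulmxA -colE; congr (_ - _).
by apply/colP => i; rewrite [LHS]mxE mul_mx_diag [LHS]mxE [RHS]mxE [x j i 0]mxE mulrC.
Qed.

Lemma residual_col_le j : inner (col j E) (col j E) <= rho ^+ 2.
Proof.
apply: (@le_trans _ _ (inner E E)).
  rewrite [X in _ <= X]inner_sum_col (bigD1 j) //= lerDl.
  by apply: sumr_ge0 => k _; apply: inner_ge0.
by rewrite -sqr_frob ler_sqr ?nnegrE ?frob_ge0 // ltW.
Qed.

Lemma frob_col_residual_le j : frob (col j E) <= rho.
Proof.
by rewrite -ler_sqr ?nnegrE ?frob_ge0 ?(ltW rho_gt0) // sqr_frob residual_col_le.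
Qed.

Lemma inner_col_tr j (u : 'cV[R]_N) : inner (x j) u = (X^T *m u) j 0.
Proof. by rewrite colE inner_mull inner_delta. Qed.

Lemma mul_M_sym (u v : 'cV[R]_N) : inner (M *m u) v = inner u (M *m v).
Proof. by rewrite inner_mull Msym. Qed.

Lemma low_ritz_descent j : a j <= lam r + rho -> exists U,
  [/\ tangent X U, U != 0 & hessg M X U <= - (d - 2 * rho) * inner U U].
Proof.
move=> aj; pose F : 'M[R]_(N, r) := Q *m pid_mx r.
have FF : stiefel F.
  rewrite /stiefel /F trmx_mul -mulmxA (mulmxA Q^T) QQ mul1mx tr_pid_mx pid_mx_id.
    by rewrite pid_mx_1.
  exact: ltnW.
have r1 : (r.-1 < r)%N by case: (r) j {aj} => [[]|].
have [v v0 vker] := exists_ker (row' j (X^T *m F)) r1.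
pose w := F *m v; pose al := inner (x j) w; pose u := w - al *: x j.
have w0 : inner w w != 0 by rewrite inner_stiefel // inner_eq0.
have wperp i : i != j -> inner (x i) w = 0.
  rewrite eq_sym => /unlift_some[k -> _].
  rewrite inner_col_tr /w mulmxA.
  have /colP/(_ k) := vker; rewrite !mxE => {2}<-.
  by apply: eq_bigr => l _; rewrite !mxE.
have Xu : X^T *m u = 0.
  apply/colP => i; rewrite -inner_col_tr innerDr innerNr innerZr inner_colX // [RHS]mxE.
  have [->|ij] := eqVneq i j; first by rewrite mulr1 subrr.
  by rewrite wperp // mulr0 subr0.
have xu : inner u (x j) = 0 by rewrite innerC inner_col_tr Xu mxE.
have wE : w = u + al *: x j by rewrite subrK.
have top : (lam r + d) * inner w w <= inner w (M *m w).
  rewrite /w /F; apply: (quad_top _ ME) => // t tr.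
  by have := gap tr tr rN; lra.
clearbody u al w.
have Mx : M *m x j = a j *: x j + col j E by rewrite col_residual addrC subrK.
pose q := inner u (col j E).
have q_le : `|q| <= frob u * rho.
  by apply: (le_trans (inner_Cauchy_Schwarz _ _)); rewrite ler_wpM2l ?frob_ge0 // frob_col_residual_le.
have uMx : inner u (M *m x j) = q by rewrite Mx innerDr innerZr xu mulr0 add0r.
have ww : inner w w = inner u u + al ^+ 2.
  rewrite wE !(innerDl, innerDr, innerZl, innerZr) inner_colX // eqxx (innerC (x j)) xu /=; ring.
have wMw : inner w (M *m w) = inner u (M *m u) + 2 * al * q + al ^+ 2 * a j.
  rewrite wE mulmxDr -scalemxAr !(innerDl, innerDr, innerZl, innerZr).
  rewrite inner_colMX // -ritzE -(mul_M_sym (x j) u) (innerC (M *m x j) u) uMx; ring.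
have key : (d - 2 * rho) * (inner u u + al ^+ 2) <= inner u (M *m u) - a j * inner u u.
  have u2 := sqr_frob u; have u0 := frob_ge0 u.
  have cross : 2 * al * q <= rho * (inner u u + al ^+ 2).
    have alq : al * q <= `|al| * (frob u * rho).
      by apply: (le_trans (ler_norm _)); rewrite normrM ler_wpM2l.
    have al2 : `|al| ^+ 2 = al ^+ 2 by rewrite real_normK ?num_real.
    have := mulr_ge0 (ltW rho_gt0) (sqr_ge0 (`|al| - frob u)).
    by rewrite -u2 -al2; nra.
  have h1 := ler_wpM2r (inner_ge0 u) aj.
  have h2 := ler_wpM2r (sqr_ge0 al) aj.
  by rewrite ww wMw in top; nra.
have dp : 0 < d - 2 * rho by have := rho_gt0; have := rho_small; lra.
have u0 : inner u u != 0.
  apply/eqP => u0; move: w0; rewrite ww u0 add0r => /negP; apply.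
  move: key; have /eqP -> : u == 0 by rewrite -inner_eq0 u0.
  rewrite inner0l mulmx0 inner0r mulr0 subr0 add0r => key.
  by rewrite eq_le sqr_ge0 andbT -(pmulr_rle0 _ dp).
have UU : inner (u *m (delta_mx 0 j : 'rV[R]_r)) (u *m (delta_mx 0 j : 'rV[R]_r)) = inner u u.
  by rewrite inner_rank1 inner_delta mxE !eqxx mulr1.
exists (u *m delta_mx 0 j); split.
- by apply: tangent_ortho; rewrite mulmxA Xu mul0mx.
- by rewrite -inner_eq0 UU.
rewrite UU hess_normal.
have n1 := Ndiag_ge1 (R := R) j; have p := inner_ge0 u; have p' := sqr_ge0 al.
have h : (d - 2 * rho) * inner u u <= inner u (M *m u) - a j * inner u u.
  by have := mulr_ge0 (ltW dp) p'; lra.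
have h0 := mulr_ge0 (ltW dp) p.
by nra.
Qed.

Lemma inversion_descent (i j : 'I_r) : (i < j)%N -> d - 2 * rho <= a j - a i -> exists U,
  [/\ tangent X U, U != 0 & hessg M X U <= - ((d - 2 * rho) / 2) * inner U U].
Proof.
move=> lt_ij aij; have ij : i != j by apply/eqP => e; rewrite e ltnn in lt_ij.
exists (rotation X i j); split.
- exact: tangent_rotation.
- by rewrite -inner_eq0 inner_rotation // pnatr_eq0.
rewrite inner_rotation // hess_rotation //.
have pos : 0 <= a j - a i by have := rho_gt0; have := rho_small; lra.
have nij : 0 <= (r - i)%:R - (r - j)%:R - 1 :> R.
  by have := Ndiag_decr (R := R) lt_ij; lra.
by have := mulr_ge0 nij pos; lra.
Qed.

Section HighRitz.
Hypothesis high : forall j, lam r + rho < a j.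

Lemma ritz_near j : exists s : 'I_N, (s < r)%N /\ `|lam s - a j| <= rho.
Proof.
have xj : inner (x j) (x j) = 1 by rewrite inner_colX // eqxx.
have [||s hs] := eigenvalue_near QQ ME (x := x j) (a := a j) (rho := rho) _ (ltW rho_gt0).
- by rewrite -inner_eq0 xj oner_eq0.
- by rewrite xj mulr1 -col_residual residual_col_le.
exists s; split => //; rewrite ltnNge; apply/negP => rs.
have := bottom rs (ltn_ord s); have := high j.
by move: hs; rewrite ler_norml => /andP[h _] h1 h2; lra.
Qed.

Lemma ritz_ge j : lam r + d - rho <= a j.
Proof.
have [s [sr]] := ritz_near j; rewrite ler_norml => /andP[_ h].
by have := gap sr sr rN; lra.
Qed.

Lemma eigengap (s t : 'I_N) : (s < r)%N -> t != s -> d <= `|lam t - lam s|.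
Proof.
move=> sr ts; have [lt|lt|/val_inj e] := ltngtP s t.
- by rewrite distrC; apply: le_trans (ler_norm _); apply: gap.
- by apply: le_trans (ler_norm _); apply: gap (ltn_trans lt sr) lt (ltn_ord s).
- by rewrite e eqxx in ts.
Qed.

Lemma ritz_concentrated j (s : 'I_N) : (s < r)%N -> `|lam s - a j| <= rho ->
  \sum_(t | t != s) (Q^T *m x j) t 0 ^+ 2 <= 1 / 4.
Proof.
move=> sr hs; apply: (coord_concentrated QQ ME (a := a j) rho_gt0).
  by rewrite -col_residual residual_col_le.
move=> t ts; have := eigengap sr ts.
have := ler_normD (lam t - a j) (a j - lam s); rewrite addrA subrK (distrC (a j)).
have := normr_ge0 (lam t - a j); have := rho_gt0; have := rho_small; lra.
Qed.

Lemma ritz_sep i j : i != j -> d - 2 * rho <= `|a i - a j|.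
Proof.
move=> ij; have [s [sr hs]] := ritz_near i; have [t [tr ht]] := ritz_near j.
have [e|ts] := eqVneq t s.
  rewrite e in ht; exfalso.
  apply: (concentrated_not_ortho QQ (x := x i) (y := x j) (s := s)).
  - by rewrite inner_colX // eqxx.
  - by rewrite inner_colX // eqxx.
  - by rewrite inner_colX // (negbTE ij).
  - exact: ritz_concentrated.
  - exact: ritz_concentrated.
have := eigengap sr ts; have := ler_normD (lam t - a j) (a j - a i).
have := ler_normD (lam t - a i) (a i - lam s).
rewrite !addrA !subrK (distrC (a j)) (distrC (a i) (lam s)).
by move: (ht) (hs); lra.
Qed.

Lemma quad_normal (u : 'cV[R]_N) : X^T *m u = 0 ->
  inner u (M *m u) <= (lam r + 2 * rho) * inner u u.
Proof.
move=> Xu; rewrite leNgt; apply/negP => big.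
pose F : 'M[R]_(N, r) := Q *m pid_mx r.
have rr : (r < r + 1)%N by rewrite addn1.
have [w w0 Fw] := exists_ker (F^T *m row_mx X u) rr.
pose al := usubmx w; pose be := dsubmx w 0 0.
have wE : w = col_mx al be%:M by rewrite -mx11_scalar vsubmxK.
pose y := X *m al + be *: u.
have Fy : F^T *m y = 0.
  by rewrite -Fw -mulmxA wE mul_row_col mul_mx_scalar.
have ybot := quad_bot QQ ME (fun (t : 'I_N) rt => bottom rt (ltn_ord t)) Fy.
have yy : inner y y = inner al al + be ^+ 2 * inner u u.
  rewrite /y !(innerDl, innerDr, innerZl, innerZr) (innerC u) !(inner_ortho al Xu).
  by rewrite inner_stiefel //; ring.
pose q := inner (E *m al) u; pose p := inner (X *m al) (E *m al).
pose b := inner al (diag_mx (ritz M X) *m al).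
have MXal : M *m (X *m al) = X *m (diag_mx (ritz M X) *m al) + E *m al.
  by rewrite (mulmxA M X) (mul_M_X M X) mulmxDl -mulmxA.
have yMy : inner y (M *m y) = b + p + 2 * be * q + be ^+ 2 * inner u (M *m u).
  rewrite /y mulmxDr -scalemxAr MXal.
  rewrite !(innerDl, innerDr, innerZl, innerZr) inner_stiefel //.
  rewrite (innerC u (X *m _)) (inner_ortho _ Xu) (innerC u (E *m _)).
  rewrite -(mul_M_sym (X *m al)) MXal innerDl.
  by rewrite (inner_ortho _ Xu) -/q -/p -/b; ring.
have b_ge : (lam r + d - rho) * inner al al <= b.
  rewrite /b !innerE mulr_sumr; apply: ler_sum => i _; rewrite !big_ord1.
  rewrite mul_diag_mx [X in _ <= _ * X]mxE [X in _ <= X]mulrCA -!expr2.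
  by rewrite ler_wpM2r ?sqr_ge0 ?ritz_ge.
have fEal : frob (E *m al) <= rho * frob al.
  by apply: (le_trans (frob_mulmx _ _)); rewrite ler_wpM2r ?frob_ge0.
have fXal : frob (X *m al) = frob al by rewrite !frobE inner_stiefel.
have al2 := sqr_frob al; have u2 := sqr_frob u.
have p_le : `|p| <= rho * inner al al.
  apply: (le_trans (inner_Cauchy_Schwarz _ _)); rewrite fXal -al2 expr2 mulrCA.
  by rewrite ler_wpM2l ?frob_ge0.
have q_le : `|q| <= rho * frob al * frob u.
  by apply: (le_trans (inner_Cauchy_Schwarz _ _)); rewrite ler_wpM2r ?frob_ge0.
have cross : - (rho * (inner al al + be ^+ 2 * inner u u)) <= 2 * be * q.
  have beq : - (be * q) <= `|be| * (rho * frob al * frob u).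
    by apply: (le_trans (ler_norm _)); rewrite normrN normrM ler_wpM2l.
  have be2 : `|be| ^+ 2 = be ^+ 2 by rewrite real_normK ?num_real.
  have := mulr_ge0 (ltW rho_gt0) (sqr_ge0 (frob al - `|be| * frob u)).
  by rewrite -be2 -al2 -u2; nra.
move: p_le; rewrite ler_norml => /andP[p_ge _].
rewrite yy yMy in ybot.
have be0 := sqr_ge0 be; have al0 := inner_ge0 al; have uu0 := inner_ge0 u.
have big' : (lam r + 2 * rho) * inner u u * be ^+ 2 <= inner u (M *m u) * be ^+ 2.
  by apply: ler_wpM2r => //; apply: ltW.
have sum_le0 : (d - 3 * rho) * inner al al + rho * (be ^+ 2 * inner u u) <= 0 by nra.
have d3 : 0 < d - 3 * rho by have := rho_gt0; have := rho_small; lra.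
have beu : 0 <= be ^+ 2 * inner u u by exact: mulr_ge0.
have alz : inner al al = 0.
  apply/eqP; rewrite eq_le al0 andbT -(pmulr_rle0 _ d3).
  by have := mulr_ge0 (ltW rho_gt0) beu; lra.
have bez : be ^+ 2 * inner u u = 0.
  apply/eqP; rewrite eq_le beu andbT -(pmulr_rle0 _ rho_gt0).
  by move: sum_le0; rewrite alz mulr0 add0r.
have u0 : inner u u != 0.
  apply: contraTneq big => uz; have /eqP -> : u == 0 by rewrite -inner_eq0 uz.
  by rewrite mulmx0 inner0r mulr0 ltxx.
move/eqP: bez; rewrite mulf_eq0 (negbTE u0) orbF sqrf_eq0 => /eqP bez.
move/eqP: alz; rewrite inner_eq0 => /eqP alz.
by move: w0; rewrite wE alz bez raddf0 col_mx0 eqxx.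
Qed.

Lemma sorted_hess_ge U : (forall i j : 'I_r, (i < j)%N -> a j <= a i) ->
  36 * (r%:R * rho) <= d -> tangent X U ->
  (14 / 36 * d) * inner U U <= hessg M X U.
Proof.
move=> sorted rr tU.
pose Om := X^T *m U; pose K := U - X *m Om.
have XK : X^T *m K = 0 by apply: stiefel_split.
have UE : U = X *m Om + K by rewrite addrC subrK.
have Omskew : Om^T = - Om.
  by apply/eqP; rewrite -addr_eq0 addrC /Om trmx_mul trmxK; apply/eqP.
have d2 : 34 / 36 * d <= d - 2 * rho by have := rho_small; lra.
have d3 : 33 / 36 * d <= d - 3 * rho by have := rho_small; lra.
have d0 : 0 <= d by have := rho_small; have := rho_gt0; lra.
have sep (i j : 'I_r) : (i < j)%N -> 34 / 36 * d <= a i - a j.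
  move=> ij; have ne : i != j by apply/eqP => e; rewrite e ltnn in ij.
  by have := ritz_sep ne; rewrite ger0_norm ?subr_ge0 ?sorted // => h; lra.
clearbody Om K.
have h1 : 34 / 36 * d / 2 * inner Om Om <=
    inner (Om *m diag_mx (ritz M X) - diag_mx (ritz M X) *m Om) (Om *m Ndiag R r).
  by apply: skew_part_ge => //; lra.
have h2 : 33 / 36 * d * inner K K <=
    inner (K *m diag_mx (ritz M X) - M *m K) (K *m Ndiag R r).
  apply: (normal_part_ge XK _ _ quad_normal); first by lra.
  by move=> j; have := ritz_ge j; lra.
have h3 := hess_split_error XX Om XK resid.
have UU : inner U U = inner K K + inner Om Om by rewrite UE addrC pythagoras.
rewrite [hessg M X U](congr1 _ UE) hess_split // -UE.
rewrite -UE in h3.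
have k0 := mulr_ge0 d0 (inner_ge0 K).
have u0 : 36 * (r%:R * rho) * inner U U <= d * inner U U by apply: ler_wpM2r => //; apply: inner_ge0.
rewrite UU in u0 h3 *; lra.
Qed.

End HighRitz.
End NearCritical.

Lemma eigengap_dmin (R : realType) (r N : nat) (lam : nat -> R) :
  (forall i : nat, (r <= i)%N -> (i.+1 < N)%N -> lam i.+1 <= lam i) ->
  (forall t : nat, (r <= t)%N -> (t < N)%N -> lam t <= lam r) /\
  (forall s t : nat, (s < r)%N -> (s < t)%N -> (t < N)%N -> dmin r lam <= lam s - lam t).
Proof.
move=> mono.
have bottom t : (r <= t)%N -> (t < N)%N -> lam t <= lam r.
  elim: t => [|t IH]; first by rewrite leqn0 => /eqP ->.
  rewrite leq_eqVlt => /orP[/eqP -> //|rt tN].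
  by apply: (le_trans (mono _ rt tN)); apply: IH => //; apply: ltnW.
have gap s t : (s < t)%N -> (t <= r)%N -> dmin r lam <= lam s - lam t.
  move=> st tr; have sr : (s < r.+1)%N by apply: leq_trans (ltnW st) _.
  have tr' : (t < r.+1)%N by [].
  apply: (le_trans (bigmin_le _ (Ordinal sr) _)).
  exact: (@bigmin_le_cond _ _ _ _ (Ordinal tr') _ (fun j : 'I_r.+1 => lam s - lam j)).
split=> // s t sr st tN; have [tr|rt] := leqP t r; first exact: gap.
have := gap s r sr (leqnn r); have := bottom t (ltnW rt) tN; lra.
Qed.

Theorem theorem3 (R : realType) (N r : nat) (M : 'M[R]_N) (lam : nat -> R) :
  (0 < r)%N -> (r < N)%N ->
  M^T = M ->
  char_poly M = \prod_(i < N) ('X - (lam i)%:P) ->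
  (forall i : nat, (i < r)%N -> lam i.+1 < lam i) ->
  (forall i : nat, (r <= i)%N -> (i.+1 < N)%N -> lam i.+1 <= lam i) ->
  forall X : 'M[R]_(N, r), stiefel X ->
  frob (gradg M X) <= (72 * r%:R)^-1 * dmin r lam ->
  (11 / 100) * dmin r lam <= `| lam_min_hess M X |.
Proof.
move=> r0 rN Msym Mchar _ mono X XX grad_small.
have [d0|d0] := leP (dmin r lam) 0; first by apply: le_trans (normr_ge0 _); lra.
have [bottom gap] := eigengap_dmin mono.
have [Q [QQ ME]] := spectral_theorem Msym Mchar.
move: (dmin r lam) d0 gap grad_small => d d0 gap grad_small.
pose rho := 2 * ((72 * r%:R)^-1 * d).
have r1 : 1 <= r%:R :> R by rewrite ler1n.
have rrho : 36 * (r%:R * rho) = d.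
  by rewrite /rho; field; rewrite pnatr_eq0 -lt0n.
have rho_gt0 : 0 < rho by rewrite /rho !mulr_gt0 ?invr_gt0 ?mulr_gt0 // (lt_le_trans _ r1).
have rho_small : 36 * rho <= d by rewrite -rrho; nra.
have resid : frob (residual M X) <= rho.
  rewrite -ler_sqr ?nnegrE ?frob_ge0 ?(ltW rho_gt0) // sqr_frob.
  apply: (le_trans (residual_le_grad M XX)); rewrite -sqr_frob.
  have : frob (gradg M X) ^+ 2 <= ((72 * r%:R)^-1 * d) ^+ 2.
    rewrite ler_sqr ?nnegrE ?frob_ge0 //.
    exact: le_trans (frob_ge0 _) grad_small.
  by rewrite /rho exprMn; lra.
clearbody rho.
have neg U c : 11 / 100 * d <= c -> tangent X U -> U != 0 ->
    hessg M X U <= - c * inner U U -> 11 / 100 * d <= `|lam_min_hess M X|.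
  move=> hc tU U0 hU; have := lam_min_hess_le tU U0 hU.
  by move=> h; apply: (le_trans _ (_ : - lam_min_hess M X <= _)); [lra | rewrite -normrN ler_norm].
have [/existsP[j aj]|/existsPn high] := boolP [exists j, ritz M X 0 j <= lam r + rho].
  have [U [tU U0 hU]] := low_ritz_descent Msym XX QQ ME rN gap rho_gt0 rho_small resid aj.
  by apply: neg tU U0 hU; lra.
have {}high j : lam r + rho < ritz M X 0 j by rewrite ltNge high.
have [/existsP[i /existsP[j /andP[ij aij]]]|/existsPn sorted] :=
    boolP [exists i : 'I_r, exists j : 'I_r, (i < j)%N && (ritz M X 0 i < ritz M X 0 j)].
  have ne : i != j by apply/eqP => e; rewrite e ltnn in ij.
  have sep := ritz_sep XX QQ ME gap bottom rho_gt0 rho_small resid high ne.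
  rewrite ltr0_norm ?subr_lt0 // opprB in sep.
  have [U [tU U0 hU]] := inversion_descent XX rho_gt0 rho_small ij sep.
  by apply: neg tU U0 hU; lra.
apply: le_trans (ler_norm _); apply: (@le_trans _ _ (14 / 36 * d)); first by lra.
apply: lam_min_hess_ge => // U tU.
apply: (sorted_hess_ge Msym XX QQ ME rN gap bottom rho_gt0 rho_small resid high) => //.
  move=> i j ij; have /existsPn/(_ j) := sorted i.
  by rewrite ij /= -leNgt.
by rewrite rrho.
Qed.
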